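(* Let $\varepsilon$ be any finite soft excursion. Then the Head-Tail (HT) soliton decomposition of $\varepsilon$ coincides with the tree decomposition of $\varepsilon$: for every $k\ge 1$, the $k$-solitons$^{\diamond}$ of $\varepsilon$ (as sets of boxes, with their heads and tails) are exactly the $k$-solitons$^*$ of $\varepsilon$.
   Context: **Excursions.** A finite soft excursion of length $2n$ ($n\ge 0$) is a sequence $\varepsilon=(\varepsilon(0),\dots,\varepsilon(2n))$ of nonnegative integers with $\varepsilon(0)=\varepsilon(2n)=0$ and $|\varepsilon(i)-\varepsilon(i-1)|=1$ for $1\le i\le 2n$. Its ball configuration is $\eta\in\{0,1\}^{\mathbb Z}$ with $2\eta(i)-1=\varepsilon(i)-\varepsilon(i-1)$ for $1\le i\le 2n$ and $\eta(i)=0$ for all other $i$. Elements of $\mathbb Z$ are called boxes; box $i$ is occupied if $\eta(i)=1$ and empty if $\eta(i)=0$. **HT decomposition.** A run is a maximal interval of consecutive boxes with the same value of $\eta$ (a zero-run or a one-run); its size is its number of boxes (possibly $+\infty$). After some boxes have been deleted, runs are computed on the remaining boxes in their inherited order. Repeat the following until only one infinite run remains: take the leftmost among the runs of smallest size; let $k$ be its size. If it is a one-run, pair its boxes with the first (leftmost) $k$ boxes of the neighboring zero-run to its right. If it is a zero-run, pair its boxes with the nearest (rightmost) $k$ boxes of the neighboring one-run to its left. The resulting $2k$ boxes form a $k$-soliton$^\diamond$; its head is its set of $k$ occupied boxes and its tail its set of $k$ empty boxes. Delete these boxes, update the runs and repeat. **Tree of an excursion.** Regarding occupied boxes in $[1,2n]$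 as open parentheses and empty boxes in $[1,2n]$ as closed parentheses, each occupied box $i$ is matched with an empty box $j>i$ (the usual parenthesis matching). The planar rooted tree of $\varepsilon$ has a root and one further node for each matched pair $(i,j)$. The parent of the node $(i,j)$ is the node $(i',j')$ with $i'<i<j<j'$ that is innermost among such pairs, or the root if there is no such pair. Children of a node are ordered from left to right according to the position of their boxes. (Equivalently: cut the region below the graph of $\varepsilon$ by the horizontal lines at integer heights, take one node for each connected component, with the bottom component as root, and join components sharing a piece of horizontal line; the two diagonal sides of a component other than the bottom one are the steps of boxes $i$ and $j$.) **Branches.** Define the generation number and color of the non-root nodes recursively: each leaf (non-root node without children) has generation number $1$ and its own distinct color; a non-root node with children has generation number $g+1$, where $g$ is the largest generation number among its children, and receives the color of the rightmost child among those with generation number $g$. The root has a separate color. A $k$-branch is the set of all nodes of a given (non-root) color, when this set has $k$ nodes; it is a path. **Tree decomposition.** To each $k$-branch with nodes $(i_1,j_1),\dots,(i_k,j_k)$ associate the $k$-soliton$^*$ with head $\{i_1,\dots,i_k\}$ (occupied boxes) and tail $\{j_1,\dots,j_k\}$ (empty boxes). The tree decomposition of $\varepsilon$ is the collection of all its solitons$^*$. *)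

(* Defs.v *)
From mathcomp Require Import all_boot all_order all_algebra.
From mathcomp Require Import boolp classical_sets cardinality.
From mathcomp Require Import zify.

Set Implicit Arguments.
Unset Strict Implicit.
Unset Printing Implicit Defensive.

Import Order.TTheory GRing.Theory Num.Theory.

Local Open Scope classical_set_scope.
Local Open Scope card_scope.

(** * Excursions *)

(* The sequence eps(0), ..., eps(2n), as a list of length 2n+1. *)
Definition soft_excursion (n : nat) (eps : seq nat) : Prop :=
  [/\ size eps = (2 * n).+1, nth 0 eps 0 = 0, nth 0 eps (2 * n) = 0 &
      forall i, 1 <= i <= 2 * n ->
        (`|(nth 0 eps i)%:Z - (nth 0 eps i.-1)%:Z| = 1)%R].

(* [true] means occupied; [ball_configE] relates this to the increments. *)
Definition ball_config (n : nat) (eps : seq nat) (x : int) : bool :=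
  if x is Posz i then (1 <= i <= 2 * n) && (nth 0 eps i.-1 < nth 0 eps i)
  else false.

Lemma ball_configE n eps i : soft_excursion n eps -> 1 <= i <= 2 * n ->
  (2 * (nat_of_bool (ball_config n eps i%:Z))%:Z - 1
     = (nth 0 eps i)%:Z - (nth 0 eps i.-1)%:Z)%R.
Proof.
case=> _ _ _ /(_ i) step hi; move: (step hi); rewrite /ball_config hi /=.
move: (nth 0 eps i) (nth 0 eps i.-1) => a b.
case: (ltnP b a) => [lt_ba | le_ab].
  by rewrite gtr0_norm ?subr_gt0 ?ltz_nat // => ->.
by rewrite ler0_norm ?subr_le0 ?lez_nat // => /(congr1 -%R%R); rewrite opprK => ->.
Qed.

(** * Head-Tail decomposition *)

(* In this part [S] is the set of boxes that have not been deleted yet. *)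

(* A nonempty interval of consecutive boxes of [S] on which [eta] is constant. *)
Definition block (eta : int -> bool) (S A : set int) : Prop :=
  [/\ A !=set0, A `<=` S,
      (forall x y z : int, A x -> A z -> S y -> (x <= y <= z)%R -> A y) &
      exists b, forall x, A x -> eta x = b].

Definition run (eta : int -> bool) (S R : set int) : Prop :=
  block eta S R /\ forall A, block eta S A -> R `<=` A -> A = R.

Definition one_run (eta : int -> bool) (S R : set int) : Prop :=
  run eta S R /\ forall x, R x -> eta x = true.

Definition zero_run (eta : int -> bool) (S R : set int) : Prop :=
  run eta S R /\ forall x, R x -> eta x = false.

Definition left_of (A B : set int) : Prop :=
  forall x y : int, A x -> B y -> (x < y)%R.

(* [A] lies to the left of [B], and no box of [S] separates them. *)
Definition neighbors (S A B : set int) : Prop :=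
  left_of A B /\
  forall x y z : int, A x -> B z -> S y -> (x <= y <= z)%R -> A y \/ B y.

(* The leftmost among the runs of smallest size, when this size is finite and
   equal to [k]; infinite runs take part in the comparison of sizes. *)
Definition leftmost_smallest_run (eta : int -> bool) (S : set int) (k : nat)
    (R : set int) : Prop :=
  [/\ run eta S R, R #= `I_k,
      (forall R', run eta S R' -> R #<= R') &
      forall R', run eta S R' -> R' #= R -> R' <> R -> left_of R R'].

Definition leftmost_boxes (k : nat) (A B : set int) : Prop :=
  [/\ B `<=` A, B #= `I_k & left_of B (A `\` B)].

Definition rightmost_boxes (k : nat) (A B : set int) : Prop :=
  [/\ B `<=` A, B #= `I_k & left_of (A `\` B) B].

(* A soliton is given by its size, its head and its tail. *)
Definition soliton : Type := (nat * (set int * set int))%type.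

Definition HT_step (eta : int -> bool) (S : set int) (s : soliton) : Prop :=
  let: (k, (hd, tl)) := s in
     (exists R', [/\ leftmost_smallest_run eta S k hd, one_run eta S hd,
        zero_run eta S R', neighbors S hd R' & leftmost_boxes k R' tl])
  \/ (exists R', [/\ leftmost_smallest_run eta S k tl, zero_run eta S tl,
        one_run eta S R', neighbors S R' tl & rightmost_boxes k R' hd]).

Definition only_one_infinite_run (eta : int -> bool) (S : set int) : Prop :=
  exists R, [/\ run eta S R, infinite_set R &
                forall R', run eta S R' -> R' = R].

(* [HT_execution eta S l]: started on the boxes of [S], the procedure stops
   after having produced the solitons in [l], in this order. *)
Inductive HT_execution (eta : int -> bool) : set int -> seq soliton -> Prop :=
| HT_stop S : only_one_infinite_run eta S -> HT_execution eta S [::]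
| HT_continue S s l : ~ only_one_infinite_run eta S -> HT_step eta S s ->
    HT_execution eta (S `\` (s.2.1 `|` s.2.2)) l ->
    HT_execution eta S (s :: l).

(* The set of pairs (head, tail) of the k-solitons of the HT decomposition. *)
Definition HT_solitons (n : nat) (eps : seq nat) (k : nat) :
    set (set int * set int) :=
  [set ht | exists2 l, HT_execution (ball_config n eps) setT l
                     & (k, ht) \in l].

(** * Tree of an excursion *)

Definition balanced (w : bitseq) : bool :=
  (count_mem false w == count_mem true w) &&
  all (fun m => count_mem false (take m w) <= count_mem true (take m w))
      (iota 0 (size w)).

(* Parenthesis matching: [i] is open, [j] is closed, and the word of
   parentheses strictly between them is balanced. *)
Definition matched (n : nat) (eta : int -> bool) (i j : nat) : bool :=
  [&& 1 <= i, i < j, j <= 2 * n, eta (Posz i), ~~ eta (Posz j) &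
      balanced [seq eta (Posz m) | m <- iota i.+1 (j - i.+1)]].

Definition node : Type := (nat * nat)%type.

(* The non-root nodes, listed by increasing position of their left box. *)
Definition nodes (n : nat) (eta : int -> bool) : seq node :=
  [seq p <- [seq (i, j) | i <- iota 1 (2 * n), j <- iota 1 (2 * n)]
     | matched n eta p.1 p.2].

Definition encloses (q p : node) : bool := (q.1 < p.1) && (p.2 < q.2).

Definition innermost_enclosing (n : nat) (eta : int -> bool) (p q : node) :
    bool :=
  encloses q p &&
  all (fun r => encloses r p ==> ((r == q) || encloses r q)) (nodes n eta).

(* Vertices of the tree have type [option node], [None] being the root. *)
Definition parent (n : nat) (eta : int -> bool) (p : node) : option node :=
  ohead [seq q <- nodes n eta | innermost_enclosing n eta p q].

(* Ordered from left to right, as [nodes] is. *)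
Definition children (n : nat) (eta : int -> bool) (v : option node) :
    seq node :=
  [seq p <- nodes n eta | parent n eta p == v].

Definition leaf (n : nat) (eta : int -> bool) (p : node) : bool :=
  (p \in nodes n eta) && (children n eta (Some p) == [::]).

(** * Branches *)

(* The recursions along the tree are bounded by the width of the node, which
   decreases strictly from a node to its children; the equations without bound
   are [generationE] and [colorE]. *)
Fixpoint generation_rec (n : nat) (eta : int -> bool) (d : nat) (p : node) :
    nat :=
  if d is d'.+1 then
    (\max_(q <- children n eta (Some p)) generation_rec n eta d' q).+1
  else 0.

Definition generation (n : nat) (eta : int -> bool) (p : node) : nat :=
  generation_rec n eta (p.2 - p.1) p.

(* The rightmost child among those with the largest generation number. *)
Definition heir (n : nat) (eta : int -> bool) (p : node) : option node :=
  let c := children n eta (Some p) in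
  let g := \max_(q <- c) generation n eta q in
  ohead (rev [seq q <- c | generation n eta q == g]).

Fixpoint color_rec (n : nat) (eta : int -> bool) (d : nat) (p : node) : node :=
  if d is d'.+1 then
    if heir n eta p is Some q then color_rec n eta d' q else p
  else p.

(* The colors of non-root nodes are named by the leaves having these colors;
   the separate color of the root plays no role in the branches. *)
Definition color (n : nat) (eta : int -> bool) (p : node) : node :=
  color_rec n eta (p.2 - p.1) p.

Definition branch (n : nat) (eta : int -> bool) (c : node) : seq node :=
  [seq p <- nodes n eta | color n eta p == c].

(* The set of pairs (head, tail) of the k-solitons of the tree decomposition. *)
Definition tree_solitons (n : nat) (eps : seq nat) (k : nat) :
    set (set int * set int) :=
  let eta := ball_config n eps in
  [set ht | exists c, [/\ leaf n eta c, size (branch n eta c) = k,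
     ht.1 = [set Posz p.1 | p in [set` branch n eta c]] &
     ht.2 = [set Posz p.2 | p in [set` branch n eta c]]]].

(** * The recursive description of generation numbers and colors *)

Lemma mem_nodes n eta p : (p \in nodes n eta) = matched n eta p.1 p.2.
Proof.
rewrite mem_filter; case: p => i j /=; case: (boolP (matched _ _ _ _)) => //=.
case/and5P=> i1 ij j2n _ _; apply/allpairsP; exists (i, j) => /=.
by rewrite !mem_iota !add1n !ltnS i1 j2n (leq_trans (ltnW ij) j2n)
  (leq_trans i1 (ltnW ij)).
Qed.

Lemma nodes_uniq n eta : uniq (nodes n eta).
Proof.
by apply/filter_uniq/allpairs_uniq; rewrite ?iota_uniq // => -[? ?] [].
Qed.

Lemma parentP n eta p q : parent n eta p = Some q ->
  q \in nodes n eta /\ innermost_enclosing n eta p q.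
Proof.
rewrite /parent; case E: [seq _ <- _ | _] => [//|r s] [<-].
have : r \in r :: s by rewrite mem_head.
by rewrite -E mem_filter => /andP[].
Qed.

Lemma child_width n eta p q : q \in children n eta (Some p) ->
  q.2 - q.1 < p.2 - p.1.
Proof.
rewrite mem_filter mem_nodes => /andP[/eqP/parentP[_ /andP[/andP[h1 h2] _]]].
case/and5P=> _ q12 _ _ _; move: h1 h2 q12.
by case: p q => [a b] [c d] /= h1 h2 q12; lia.
Qed.

Lemma node_width n eta p : p \in nodes n eta -> 0 < p.2 - p.1.
Proof. by rewrite mem_nodes subn_gt0 => /and3P[]. Qed.

Lemma children_sub n eta v : {subset children n eta v <= nodes n eta}.
Proof. by move=> p; rewrite mem_filter => /andP[]. Qed.

Lemma children_uniq n eta v : uniq (children n eta v).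
Proof. exact/filter_uniq/nodes_uniq. Qed.

Lemma children_sorted n eta v :
  sorted (fun p q : node => p.1 <= q.1) (children n eta v).
Proof.
have tr : transitive (fun p q : node => p.1 <= q.1).
  by move=> q p r; apply: leq_trans.
apply: sorted_filter => //; apply: sorted_filter => //.
rewrite sorted_pairwise //.
have: pairwise leq (iota 1 (2 * n)).
  by rewrite -sorted_pairwise ?iota_sorted //; apply: leq_trans.
elim: {1 3}(iota _ _) => //= i s IHs /andP[/allP le_i /IHs sorted_s].
rewrite pairwise_cat sorted_s andbT; apply/andP; split.
  apply/allrelP => p q /mapP[j _ ->] /allpairsP[[k l] [hk _ ->]] /=.
  exact: le_i.
by rewrite pairwise_map; elim: (iota _ _) => //= j t ->; rewrite andbT; apply/allP => l _ /=.
Qed.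

Lemma heir_child n eta p q : heir n eta p = Some q ->
  q \in children n eta (Some p).
Proof.
rewrite /heir; set s := [seq _ <- _ | _]; case E: (rev s) => [//|r t] [<-].
have : r \in s by rewrite -mem_rev E mem_head.
by rewrite mem_filter => /andP[].
Qed.

Lemma heir_leaf n eta p : children n eta (Some p) = [::] -> heir n eta p = None.
Proof. by rewrite /heir => ->. Qed.

Lemma generation_rec_bound n eta d e p : p \in nodes n eta ->
  p.2 - p.1 <= d -> p.2 - p.1 <= e ->
  generation_rec n eta d p = generation_rec n eta e p.
Proof.
elim: d e p => [|d IHd] [|e] p /node_width; rewrite ?(leqn0, lt0n);
  do ?by move=> /negPf->.
move=> _ le_d le_e /=; congr _.+1; apply: eq_big_seq => q hq.
have lt_q := child_width hq.
by apply: IHd; [exact: children_sub hq | | ]; rewrite -ltnS (leq_trans lt_q).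
Qed.

Lemma color_rec_bound n eta d e p : p \in nodes n eta ->
  p.2 - p.1 <= d -> p.2 - p.1 <= e ->
  color_rec n eta d p = color_rec n eta e p.
Proof.
elim: d e p => [|d IHd] [|e] p /node_width; rewrite ?(leqn0, lt0n);
  do ?by move=> /negPf->.
move=> _ le_d le_e /=; case E: (heir n eta p) => [q|//].
have hq := heir_child E; have lt_q := child_width hq.
by apply: IHd; [exact: children_sub hq | | ]; rewrite -ltnS (leq_trans lt_q).
Qed.

(* The maximum over an empty range is 0, so that leaves have generation 1. *)
Lemma generationE n eta p : p \in nodes n eta ->
  generation n eta p
    = (\max_(q <- children n eta (Some p)) generation n eta q).+1.
Proof.
move=> hp; rewrite {1}/generation; move: (node_width hp).
case E: (p.2 - p.1) => [//|w] _ /=; congr _.+1; apply: eq_big_seq => q hq.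
apply: generation_rec_bound (children_sub hq) _ (leqnn _).
by rewrite -ltnS -E (child_width hq).
Qed.

Lemma colorE n eta p : p \in nodes n eta ->
  color n eta p = if heir n eta p is Some q then color n eta q else p.
Proof.
move=> hp; rewrite {1}/color; move: (node_width hp).
case E: (p.2 - p.1) => [//|w] _ /=; case Eq: (heir n eta p) => [q|//].
have hq := heir_child Eq; apply: color_rec_bound (children_sub hq) _ (leqnn _).
by rewrite -ltnS -E (child_width hq).
Qed.

(* Main.v *)
Require Import Defs.
From mathcomp Require Import all_boot all_order all_algebra.
From mathcomp Require Import finmap.
From mathcomp Require Import boolp classical_sets cardinality.
From mathcomp Require Import zify.

(** The tree and its colors are computed once and for all, and the procedure is
    followed on this fixed tree: a state is described by the set [L] of the
    colors already deleted, and the remaining boxes are those of the nodes whose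
    color is not in [L], together with the boxes outside [1, 2n]. Besides this
    description, the invariant is that the surviving nodes are closed under
    taking ancestors.

    Let [A] be a run of ones and [B] the run of zeros that follows it, among the
    remaining boxes. The surviving nodes with left box in [A] and right box in
    [B] are nested in each other, and every surviving node inside one of them
    is again one of them ([chain_nested], [chain_down]). When the procedure
    selects [A] or [B], of size [k], a counting argument shows that each box of
    the selected run is matched with a box of the other, so that this chain
    consists of [k] nodes, and the deleted boxes are those of its nodes.

    It remains to see that the chain is a whole branch ([chain_branch]). The
    survivors form a union of branches, so that the heir of a node of the chain
    survives, hence lies in the chain; going down, all the nodes of the chain
    have the color of the innermost one, which is a leaf. Going up, the point is
    that the outermost node [p1] of the chain is not the heir of its parent, when
    this parent is not the root ([one_run_top], [zero_run_top]). The generation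
    of [p1] is at most [k]. If [A] was selected, a zero separates the parent from
    [A], hence [p1] has a surviving left sibling; the runs around a leaf below
    this sibling are to the left of the leftmost smallest run, hence have more
    than [k] boxes, which gives the sibling a generation larger than [k]
    ([generation_ge_runs]). If [B] was selected, then [p1] has a surviving right
    sibling, whose generation is at least [k], because no run is smaller, and
    ties between siblings are won by the rightmost one. This is how the two
    tie-breaking rules, leftmost run and rightmost child, match.

    Deleting a whole branch preserves the invariant, a step is possible as long
    as a node survives, and when none is left only one infinite run of zeros
    remains. *)

Set Implicit Arguments.
Unset Strict Implicit.
Unset Printing Implicit Defensive.

Import Order.TTheory GRing.Theory Num.Theory.

Local Open Scope classical_set_scope.
Local Open Scope card_scope.
Local Open Scope nat_scope.

(** * Cardinals and maxima *)

Lemma bigmax_seq_attained (T : eqType) (F : T -> nat) (s : seq T) (x : T) :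
  exists2 y, y \in x :: s & F y = \max_(z <- x :: s) F z.
Proof.
elim: s x => [|y s IHs] x; first by exists x; rewrite ?mem_head // big_seq1.
rewrite big_cons; have [z hz <-] := IHs y.
have [le|lt] := leqP (F z) (F x).
  by exists x; rewrite ?mem_head.
by exists z => //; rewrite inE hz orbT.
Qed.

Lemma card_image_uniq (T : eqType) (U : Type) (f : T -> U) (s : seq T) :
  uniq s -> {in s &, injective f} -> [set f x | x in [set` s]] #= `I_(size s).
Proof.
case: s => [_ _|x0 s' us injf].
  suff -> : [set f x | x in [set` Nil T]] = set0 by rewrite II0 card_eq00.
  by rewrite -subset0 => y [x].
set s := x0 :: s' in us injf *.
have -> : [set f x | x in [set` s]] = [set f (nth x0 s i) | i in `I_(size s)].
  apply/seteqP; split=> _ [x xs <-]; last by exists (nth x0 s x) => //; exact: mem_nth.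
  by exists (index x s); [rewrite /mkset index_mem | rewrite nth_index].
apply: inj_card_eq => i j; rewrite !inE => hi hj.
move=> /(injf _ _ (mem_nth x0 (hi : i < size s)) (mem_nth x0 (hj : j < size s))).
by move/eqP; rewrite nth_uniq // => /eqP.
Qed.

Lemma card_II_inj (T : Type) (A : set T) k m : A #= `I_k -> A #= `I_m -> k = m.
Proof. by move=> Ak Am; apply/card_eq_II; rewrite -(card_eql Ak). Qed.

Lemma card_II_le (T : Type) (A : set T) k m : `I_k #<= A -> A #= `I_m -> k <= m.
Proof. by move=> Ak Am; rewrite -card_le_II -(card_le_eqr Am). Qed.

Lemma card_II_succ (T : Type) (A : set T) k :
  `I_k #<= A -> ~ (A #= `I_k) -> `I_k.+1 #<= A.
Proof.
move=> kA nAk; case: (pselect (finite_set A)) => [/finite_setP[m Am]|].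
  rewrite (card_le_eqr Am) card_le_II ltn_neqAle (card_II_le kA Am) andbT.
  by apply: contra_notN nAk => /eqP ->.
by move/infiniteP; apply: card_le_trans; apply: card_leT.
Qed.

Lemma subset_card_II (T : choiceType) (A B : set T) k :
  A `<=` B -> A #= `I_k -> B #= `I_k -> A = B.
Proof.
move=> AB Ak Bk.
have fA : finite_set A by apply/finite_setP; exists k.
have fB : finite_set B by apply/finite_setP; exists k.
apply: fset_set_inj => //; apply/eqP; rewrite eqEfcard.
by rewrite (card_fset_set Ak) (card_fset_set Bk) leqnn andbT -fset_set_sub.
Qed.

(** Two initial parts of a totally ordered set are comparable for inclusion, so
    they are equal as soon as they have the same finite size. *)
Lemma leftmost_boxes_inj k R A B :
  leftmost_boxes k R A -> leftmost_boxes k R B -> A = B.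
Proof.
move=> [AR Ak Al] [BR Bk Bl]; case: (pselect (A `<=` B)) => [AB|].
  exact: subset_card_II AB Ak Bk.
move=> /existsNP[x /not_implyP[Ax nBx]]; apply/esym/(subset_card_II _ Bk Ak).
move=> y By; apply: contrapT => nAy.
have := Bl y x By (conj (AR _ Ax) nBx); have := Al x y Ax (conj (BR _ By) nAy).
by lia.
Qed.

Lemma rightmost_boxes_inj k R A B :
  rightmost_boxes k R A -> rightmost_boxes k R B -> A = B.
Proof.
move=> [AR Ak Al] [BR Bk Bl]; case: (pselect (A `<=` B)) => [AB|].
  exact: subset_card_II AB Ak Bk.
move=> /existsNP[x /not_implyP[Ax nBx]]; apply/esym/(subset_card_II _ Bk Ak).
move=> y By; apply: contrapT => nAy.
have := Bl x y (conj (AR _ Ax) nBx) By; have := Al y x (conj (BR _ By) nAy) Ax.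
by lia.
Qed.

(** * Runs *)

Section Runs.

Variables (eta : int -> bool) (S : set int).

(** The maximal block around [x]. As each run is of this form ([run_eq]), the
    maximality condition in [run] need not be handled again. *)
Definition run_at (x : int) : set int :=
  [set y | S y /\ forall z, S z -> (x <= z <= y)%R || (y <= z <= x)%R ->
    eta z = eta x].

Lemma run_at_refl x : S x -> run_at x x.
Proof. by move=> Sx; split=> // z _ ?; congr eta; lia. Qed.

Lemma run_at_sub x y : run_at x y -> S y.
Proof. by case. Qed.

Lemma run_at_eta x y : run_at x y -> eta y = eta x.
Proof. by case=> Sy; apply=> //; lia. Qed.

Lemma run_at_convex x y z w : run_at x y -> run_at x w -> S z ->
  (y <= z <= w)%R -> run_at x z.
Proof.
move=> [_ xy] [_ xw] Sz yzw; split=> // v Sv xvz.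
by case: (leP v x) => vx; [apply: xy | apply: xw] => //; lia.
Qed.

Lemma run_at_block x : S x -> block eta S (run_at x).
Proof.
move=> Sx; split; first by exists x; apply: run_at_refl.
- exact: run_at_sub.
- by move=> y z w xy xw Sz yzw; apply: (run_at_convex xy xw).
- by exists (eta x) => y /run_at_eta.
Qed.

Lemma block_run_at A x : block eta S A -> A x -> A `<=` run_at x.
Proof.
case=> _ AS Ac [b Ab] Ax y Ay; split; first exact: AS.
move=> z Sz /orP[] xzy; rewrite (Ab x) //.
  by apply: Ab; apply: (Ac x z y).
by apply: Ab; apply: (Ac y z x).
Qed.

Lemma run_run_at x : S x -> run eta S (run_at x).
Proof.
move=> Sx; split=> [|A bA xA]; first exact: run_at_block.
by apply/seteqP; split=> //; apply/block_run_at/xA/run_at_refl.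
Qed.

Lemma run_eq R x : run eta S R -> R x -> R = run_at x.
Proof.
move=> [bR maxR] Rx; apply/esym/maxR; last exact: block_run_at.
by apply: run_at_block; case: bR => _ RS _ _; apply: RS.
Qed.

Lemma run_witness R : run eta S R -> exists2 x, S x & R = run_at x.
Proof.
move=> rR; have [[[x Rx] RS _ _] _] := rR.
by exists x; [apply: RS | apply: run_eq].
Qed.

Lemma runs_ordered R R' : run eta S R -> run eta S R' -> R <> R' ->
  left_of R R' \/ left_of R' R.
Proof.
move=> rR rR' neq; have [x Sx eR] := run_witness rR.
have [x' Sx' eR'] := run_witness rR'.
have Rx : R x by rewrite eR; apply: run_at_refl.
have Rx' : R' x' by rewrite eR'; apply: run_at_refl.
have disj z : R z -> R' z -> False.
  by move=> Rz R'z; apply: neq; rewrite (run_eq rR Rz) (run_eq rR' R'z).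
have cR y z w : R y -> R w -> S z -> (y <= z <= w)%R -> R z.
  by rewrite eR; apply: run_at_convex.
have cR' y z w : R' y -> R' w -> S z -> (y <= z <= w)%R -> R' z.
  by rewrite eR'; apply: run_at_convex.
have sR z : R z -> S z by rewrite eR => -[].
have sR' z : R' z -> S z by rewrite eR' => -[].
case: (ltP x x') => xx'; [left=> y y' Ry Ry' | right=> y' y Ry' Ry];
  rewrite ltNge; apply/negP => le.
  case: (leP x y') => xy'; first by apply: (disj y') => //; apply: (cR x y' y); auto; lia.
  by apply: (disj x) => //; apply: (cR' y' x x'); auto; lia.
case: (leP x' y) => xy; first by apply: (disj y) => //; apply: (cR' x' y y'); auto; lia.
by apply: (disj x') => //; apply: (cR y x' x); auto; lia.
Qed.

Lemma one_run_at x : S x -> eta x -> one_run eta S (run_at x).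
Proof. by move=> Sx ex; split=> [|y /run_at_eta->]; first exact: run_run_at. Qed.

Lemma zero_run_at x : S x -> ~~ eta x -> zero_run eta S (run_at x).
Proof.
move=> Sx ex; split=> [|y /run_at_eta->]; first exact: run_run_at.
exact: negbTE.
Qed.

(** Two boxes with no unrelated box between them lie in neighboring runs, by
    convexity of the runs. *)
Lemma run_neighbors i j : S i -> S j -> eta i -> ~~ eta j -> (i < j)%R ->
  (forall z, S z -> (i < z < j)%R -> run_at i z \/ run_at j z) ->
  neighbors S (run_at i) (run_at j).
Proof.
move=> Si Sj ei ej ij hz.
have ti x : run_at i x -> eta x by move/run_at_eta->.
have tj x : run_at j x -> ~~ eta x by move/run_at_eta->.
have lti x : run_at i x -> (x < j)%R.
  move=> rx; rewrite ltNge; apply/negP => le; case/negP: ej.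
  by apply: ti; apply: (run_at_convex (run_at_refl Si) rx Sj); lia.
have ltj x : run_at j x -> (i < x)%R.
  move=> rx; rewrite ltNge; apply/negP => le.
  suff /tj : run_at j i by rewrite ei.
  by apply: (run_at_convex rx (run_at_refl Sj) Si); lia.
split=> [x y rx ry | x y z rx rz Sy xyz].
  rewrite ltNge; apply/negP => le; case/negP: (tj _ ry); apply: ti.
  have := lti _ rx; have := ltj _ ry => lt lt'.
  by apply: (run_at_convex (run_at_refl Si) rx (run_at_sub ry)); lia.
case: (leP y i) => yi.
  by left; apply: (run_at_convex rx (run_at_refl Si) Sy); lia.
case: (leP j y) => yj; last by apply: hz => //; lia.
by right; apply: (run_at_convex (run_at_refl Sj) rz Sy); lia.
Qed.

End Runs.
Arguments ball_config : simpl never.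
Arguments matched : simpl never.

Section Excursion.

Variables (n : nat) (eps : seq nat).
Hypothesis heps : soft_excursion n eps.

Local Notation eta := (ball_config n eps).
Local Notation h i := (nth 0 eps i).

(** * Parenthesis matching *)

Lemma ball_range x : eta x -> exists2 i, x = Posz i & 1 <= i <= 2 * n.
Proof. by case: x => // i /andP[? _]; exists i. Qed.

Lemma height_ball i : 1 <= i <= 2 * n ->
  h i.-1 + eta (Posz i) = h i + ~~ eta (Posz i).
Proof.
move=> hi; have: (2 * (nat_of_bool (eta (Posz i)))%:Z - 1
  = (h i)%N%:Z - (h i.-1)%N%:Z)%R := ball_configE heps hi.
by case: (ball_config n eps _) => /=; lia.
Qed.

Lemma height_count i l : i + l <= 2 * n ->
  count_mem true [seq eta (Posz m) | m <- iota i.+1 l] + h i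
  = count_mem false [seq eta (Posz m) | m <- iota i.+1 l] + h (i + l).
Proof.
elim: l => [|l IHl] hl; first by rewrite addn0.
have := IHl ltac:(lia); have := @height_ball (i + l.+1) ltac:(lia).
rewrite -addn1 iotaD map_cat !count_cat /= addn1 !addn0 addSn -addnS /=.
by case: (eta (Posz (i + l).+1)) => /=; rewrite ?addnS /=; lia.
Qed.

(** In terms of heights, the word between [i] and [j] is balanced when the path
    starts and ends there at the same height and never goes below it. *)
Lemma matchedP i j : matched n eta i j <->
  [/\ 1 <= i < j /\ j <= 2 * n, eta (Posz i), ~~ eta (Posz j), h j.-1 = h i &
      forall m, i <= m < j -> h i <= h m].
Proof.
split.
  case/and5P=> i1 ij j2n ei /andP[ej /andP[/eqP eqc /allP alln]].
  have hj := @height_count i (j - i.+1) ltac:(lia).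
  have ej' : i + (j - i.+1) = j.-1 by lia.
  split=> //; first by rewrite i1 ij.
    by rewrite ej' in hj; lia.
  move=> m im; case: (eqVneq m j.-1) => [->|mj].
    by rewrite ej' in hj; lia.
  have := alln (m - i); rewrite mem_iota size_map size_iota.
  rewrite -map_take take_iota (_ : minn _ _ = m - i); last by lia.
  move/(_ ltac:(lia)); have := @height_count i (m - i) ltac:(lia).
  by rewrite (_ : i + _ = m); lia.
case=> -[/andP[i1 ij] j2n] ei ej hj le_h.
apply/and5P; split=> //; rewrite ej /=; apply/andP; split.
  have := @height_count i (j - i.+1) ltac:(lia).
  by rewrite (_ : i + _ = j.-1); lia.
apply/allP=> m; rewrite mem_iota size_map size_iota => hm.
rewrite -map_take take_iota (_ : minn _ _ = m); last by lia.
have := @height_count i m ltac:(lia); have := le_h (i + m) ltac:(lia).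
by lia.
Qed.

Lemma matched_noncrossing i j i' j' : matched n eta i j -> matched n eta i' j' ->
  i < i' < j -> j' < j.
Proof.
move=> /matchedP[[/andP[i1 ij] j2n] ei ej hj le_h].
move=> /matchedP[[/andP[i1' ij'] j2n'] ei' ej' hj' le_h'] ii'.
have := @height_ball i' ltac:(lia); have := @height_ball j ltac:(lia).
have := @height_ball j' ltac:(lia); rewrite ei' (negPf ej) (negPf ej') /= => a b c.
have := le_h i'.-1 ltac:(lia); case: (ltngtP j' j) => // [lt|eq].
  by have := le_h' j ltac:(lia); lia.
by rewrite eq in a hj'; lia.
Qed.

Lemma matched_inj_left i i' j : matched n eta i j -> matched n eta i' j -> i = i'.
Proof.
move=> m m'; have [/andP[_ ij] _] : 1 <= i < j /\ j <= 2 * n by case/matchedP: m.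
have [/andP[_ ij'] _] : 1 <= i' < j /\ j <= 2 * n by case/matchedP: m'.
case: (ltngtP i i') => // lt.
  by have := matched_noncrossing m m' ltac:(lia); lia.
by have := matched_noncrossing m' m ltac:(lia); lia.
Qed.

Lemma matched_inj_right i j j' : matched n eta i j -> matched n eta i j' -> j = j'.
Proof.
move=> /matchedP[[/andP[i1 ij] j2n] ei ej hj le_h].
move=> /matchedP[[/andP[i1' ij'] j2n'] ei' ej' hj' le_h'].
have := @height_ball j ltac:(lia); have := @height_ball j' ltac:(lia).
rewrite (negPf ej) (negPf ej') /= => a b; case: (ltngtP j j') => // lt.
  by have := le_h' j ltac:(lia); lia.
by have := le_h j' ltac:(lia); lia.
Qed.

(** The closing box is the first one after which the path is below the height
    reached by the step [i]; it exists since the path ends at height 0. *)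
Lemma matched_open i : eta (Posz i) -> exists j, matched n eta i j.
Proof.
move=> ei; have [_ [<-] hi] := ball_range ei.
have h2n : h (2 * n) = 0 by case: heps.
have hbi := height_ball hi; rewrite ei /= in hbi.
have ex : exists j, (i < j) && (h j < h i).
  exists (2 * n); rewrite h2n; apply/andP; split; last by lia.
  case: (eqVneq i (2 * n)) => [e|]; last by lia.
  by move: hbi; rewrite e h2n; lia.
case: (ex_minnP ex) => j /andP[ij hj] jmin; exists j.
have j2n : j <= 2 * n.
  apply: jmin; rewrite h2n; apply/andP; split; last by lia.
  case: (eqVneq i (2 * n)) => [e|]; last by lia.
  by move: hbi; rewrite e h2n; lia.
have le_h m : i <= m < j -> h i <= h m.
  case: (eqVneq i m) => [->//|im] hm; rewrite leqNgt; apply/negP => hlt.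
  by have := jmin m ltac:(lia); lia.
have := le_h j.-1 ltac:(lia); have := @height_ball j ltac:(lia).
by move=> hb hj1; apply/matchedP; split=> //; case: (eta (Posz j)) hb => //=; lia.
Qed.

(** The opening box is the step after the last time before [j] where the path is
    as low as after the step [j]; such a time exists since the path starts at
    height 0. *)
Lemma matched_close j : 1 <= j <= 2 * n -> ~~ eta (Posz j) ->
  exists i, matched n eta i j.
Proof.
move=> hj ej; have h0 : h 0 = 0 by case: heps.
have hbj := height_ball hj; rewrite (negPf ej) /= in hbj.
have ex : exists m, (m < j) && (h m <= h j) by exists 0; rewrite h0; lia.
have bd m : (m < j) && (h m <= h j) -> m <= j by lia.
case: (ex_maxnP ex bd) => m /andP[mj hm] mmax.
have m1 : m < j.-1.
  by case: (eqVneq m j.-1) hm => [->|]; lia.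
have gt m' : m < m' < j -> h j < h m'.
  by move=> hm'; rewrite ltnNge; apply/negP => le; have := mmax m' ltac:(lia); lia.
have hbm := @height_ball m.+1 ltac:(lia); have hm1 := gt m.+1 ltac:(lia).
have em : eta (Posz m.+1) by case: (ball_config n eps _) hbm => //=; lia.
rewrite em /= in hbm; exists m.+1; apply/matchedP; split=> //; try lia.
by move=> m' hm'; have := gt m' ltac:(lia); lia.
Qed.

(** * The tree *)

Implicit Types p q r c : node.

Local Notation nodes := (nodes n eta).
Local Notation children p := (children n eta (Some p)).
Local Notation gen := (generation n eta).
Local Notation heir := (heir n eta).
Local Notation color := (color n eta).
Local Notation leaf := (leaf n eta).
Local Notation branch := (branch n eta).

Lemma node_bounds p : p \in nodes ->
  [/\ 1 <= p.1 < p.2, p.2 <= 2 * n, eta (Posz p.1) & ~~ eta (Posz p.2)].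
Proof. by rewrite mem_nodes => /matchedP[[]]. Qed.

Lemma node_inj_left p q : p \in nodes -> q \in nodes -> p.1 = q.1 -> p = q.
Proof.
case: p q => [i j] [i' j']; rewrite !mem_nodes /= => m m' e; move: m; rewrite e.
by move/matched_inj_right => /(_ _ m') ->.
Qed.

Lemma node_inj_right p q : p \in nodes -> q \in nodes -> p.2 = q.2 -> p = q.
Proof.
case: p q => [i j] [i' j']; rewrite !mem_nodes /= => m m' e; move: m; rewrite e.
by move/matched_inj_left => /(_ _ m') ->.
Qed.

Lemma node_left_neq_right p q : p \in nodes -> q \in nodes -> p.1 <> q.2.
Proof.
by move=> /node_bounds[_ _ e _] /node_bounds[_ _ _ e'] E; rewrite -E e in e'.
Qed.

(** Geometric form of the absence of crossings. *)
Lemma node_cases p q : p \in nodes -> q \in nodes ->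
  [\/ p = q, encloses p q, encloses q p | p.2 < q.1 \/ q.2 < p.1].
Proof.
move=> hp hq.
have ncr p' q' : p' \in nodes -> q' \in nodes -> p'.1 < q'.1 < p'.2 -> q'.2 < p'.2.
  by rewrite !mem_nodes => mp mq; apply: (matched_noncrossing mp mq).
have := ncr _ _ hp hq; have := ncr _ _ hq hp.
have := node_left_neq_right hp hq; have := node_left_neq_right hq hp.
have [] := node_bounds hp; have [] := node_bounds hq.
case: (eqVneq p.1 q.1) => [/(node_inj_left hp hq)|]; first by constructor 1.
move=> ne *; have : encloses p q || encloses q p || ((p.2 < q.1) || (q.2 < p.1)).
  by rewrite /encloses; lia.
by case/orP=> [/orP[]|/orP]; [constructor 2 | constructor 3 | constructor 4].
Qed.

Lemma enclosesP p q : p \in nodes -> q \in nodes -> p.1 < q.1 < p.2 ->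
  encloses p q.
Proof.
move=> hp hq; have [] := node_bounds hp; have [] := node_bounds hq.
by case: (node_cases hp hq) => // [->|/andP[]|]; lia.
Qed.

Lemma enclosesP_right p q : p \in nodes -> q \in nodes -> p.1 < q.2 < p.2 ->
  encloses p q.
Proof.
move=> hp hq; have [] := node_bounds hp; have [] := node_bounds hq.
by case: (node_cases hp hq) => // [->|/andP[]|]; lia.
Qed.

(** [parent] returns the first node that satisfies [innermost_enclosing]; two such
    nodes would enclose each other, so it is the only one. *)
Lemma childP p q : reflect
  [/\ q \in nodes, p \in nodes, encloses p q &
      forall r, r \in nodes -> encloses r q -> r = p \/ encloses r p]
  (q \in children p).
Proof.
have -> : (q \in children p) = (parent n eta q == Some p) && (q \in nodes).
  by rewrite mem_filter.
apply: (iffP andP) => [[/eqP/parentP[hp]]|[hq hp pq inn]].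
  move=> /andP[pq /allP inn] hq; split=> // r /inn.
  by move=> /implyP H /H /orP[/eqP|]; [left | right].
split=> //; apply/eqP; have inn_p : innermost_enclosing n eta q p.
  rewrite /innermost_enclosing pq; apply/allP => r hr; apply/implyP.
  by move=> /(inn _ hr) [->|->]; rewrite ?eqxx ?orbT.
case E: (parent n eta q) => [r|]; last first.
  move: E; rewrite /parent; case F: [seq _ <- _ | _] => // _.
  by have : p \in [::] by rewrite -F mem_filter inn_p hp.
have [hr /andP[rq /allP/(_ _ hp)]] := parentP E.
rewrite pq /= => /orP[/eqP->//|pr]; case: (inn _ hr rq) => [->//|rp].
by move: pr rp; rewrite /encloses; lia.
Qed.

Lemma child_narrower p q : q \in children p -> q.2 - q.1 < p.2 - p.1.
Proof. exact: child_width. Qed.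

(** By induction on the part of the tree between [p] and [q]: when [q] is not
    itself a child of [p], some node lies strictly between them. *)
Lemma child_above p q : p \in nodes -> q \in nodes -> encloses p q ->
  exists2 r, r \in children p & r = q \/ encloses r q.
Proof.
move=> hp; have [m] := ubnP (2 * n - (q.2 - q.1)).
elim: m q => // m IHm q le_m hq pq; have [] := node_bounds hq => hq1 hq2 _ _.
case: (boolP (q \in children p)) => [|nch]; first by exists q; [|left].
have [r [hr rq pr]] : exists r, [/\ r \in nodes, encloses r q & encloses p r].
  apply: contrapT => nex; case/negP: nch; apply/childP; split=> // r hr rq.
  case: (node_cases hr hp) => [-> | rp | pr |]; [by left | by right | |].
    by case: nex; exists r.
  by move: pq rq; rewrite /encloses; lia.
have [] := node_bounds hr => hr1 hr2 _ _.
have [|//||s hs sr] := IHm r; first by move: rq; rewrite /encloses; lia.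
  by [].
exists s => //; right; case: sr => [->//|].
by move: rq; rewrite /encloses; lia.
Qed.

Lemma siblings_disjoint p q r : q \in children p -> r \in children p ->
  [\/ q = r, q.2 < r.1 | r.2 < q.1].
Proof.
move=> /childP[hq hp pq innq] /childP[hr _ pr innr].
case: (node_cases hq hr) => [->|qr|rq|[]]; do ?by constructor.
  by have := innr _ hq qr; case=> [e|]; move: pq; rewrite ?e /encloses; lia.
by have := innq _ hr rq; case=> [e|]; move: pr; rewrite ?e /encloses; lia.
Qed.

Lemma leaf_encloses c q : leaf c -> q \in nodes -> ~~ encloses c q.
Proof.
move=> /andP[hc /eqP nch] hq; apply/negP=> cq.
by have [r] := child_above hc hq cq; rewrite nch.
Qed.

(** * Generations, heirs and colors *)

Lemma generation_child p q : q \in children p -> gen q < gen p.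
Proof.
move=> hq; have [_ hp _ _] := childP _ _ hq.
by rewrite [gen p]generationE // ltnS; apply: (@leq_bigmax_seq _ _ xpredT gen).
Qed.

Lemma generation_encloses p q : p \in nodes -> q \in nodes -> encloses p q ->
  gen q < gen p.
Proof.
have [m] := ubnP (p.2 - p.1); elim: m p => // m IHm p le_m hp hq pq.
have [r hr [<-|rq]] := child_above hp hq pq; first exact: generation_child.
apply: ltn_trans (generation_child hr); apply: IHm => //.
  by have := child_narrower hr; lia.
exact: children_sub hr.
Qed.

Lemma heir_generation p q : heir p = Some q -> gen p = (gen q).+1 /\
  forall r, r \in children p -> gen r <= gen q /\ (gen r = gen q -> r.1 <= q.1).
Proof.
move=> e; have hq := heir_child e; have [_ hp _ _] := childP _ _ hq.
have gmax r : r \in children p -> gen r <= \max_(q <- children p) gen q.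
  by move=> hr; apply: (@leq_bigmax_seq _ _ xpredT gen).
move: e; rewrite generationE // /heir.
set g := \max_(_ <- _) _ in gmax *; set s := [seq _ <- _ | _].
have ss : sorted (fun p q : node => p.1 <= q.1) s.
  by apply: sorted_filter (children_sorted _ _ _) => ? ? ?; apply: leq_trans.
have ms r : (r \in s) = (gen r == g) && (r \in children p) by rewrite mem_filter.
case/lastP: s ss ms => // s q' ss ms; rewrite rev_rcons => -[eq']; subst q'.
have /andP[/eqP gq _] : (gen q == g) && (q \in children p).
  by rewrite -ms mem_rcons mem_head.
rewrite gq; split=> // r hr; split; first exact: gmax.
move=> gr; have : r \in rcons s q by rewrite ms gr hr eqxx.
rewrite mem_rcons inE => /orP[/eqP->//|rs].
move: ss; rewrite -cats1 sorted_pairwise ?pairwise_cat; last first.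
  by move=> ? ? ?; apply: leq_trans.
by case/andP=> /allrelP/(_ r q rs); rewrite inE => ->.
Qed.

Lemma heir_None p : p \in nodes -> heir p = None -> leaf p.
Proof.
move=> hp; rewrite /Defs.leaf hp /= /Defs.heir.
case E: (children p) => [//|r c] /=; set g := \max_(_ <- _) _.
have [q hq gq] : exists2 q, q \in r :: c & gen q = g.
  by apply: bigmax_seq_attained.
rewrite -/(filter _ (r :: c)); case F: (rev _) => // _.
have : q \in [::] by rewrite -F mem_rev mem_filter gq eqxx.
by [].
Qed.

Lemma color_heir p q : heir p = Some q -> color p = color q.
Proof.
move=> e; have [_ hp _ _] := childP _ _ (heir_child e).
by rewrite colorE // e.
Qed.

Lemma color_None p : p \in nodes -> heir p = None -> color p = p.
Proof. by move=> hp e; rewrite colorE // e. Qed.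

Lemma leaf_heir c : leaf c -> heir c = None.
Proof. by move=> /andP[_ /eqP/heir_leaf]. Qed.

(** The width of a node decreases when passing to its heir, so the descent ends,
    and it can only end at a leaf. *)
Lemma heir_ind (P : node -> Prop) :
  (forall p, leaf p -> P p) ->
  (forall p q, p \in nodes -> heir p = Some q -> P q -> P p) ->
  forall p, p \in nodes -> P p.
Proof.
move=> Pleaf Pheir p; have [m] := ubnP (p.2 - p.1).
elim: m p => // m IHm p le_m hp; case e: (heir p) => [q|]; last first.
  exact/Pleaf/heir_None.
apply: (Pheir p q) => //; apply: IHm; last exact: children_sub (heir_child e).
by have := child_narrower (heir_child e); lia.
Qed.

Lemma color_leaf p : p \in nodes -> leaf (color p).
Proof.
elim/heir_ind => {}p.
  by move=> lp; rewrite color_None ?leaf_heir //; case/andP: lp.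
by move=> q hp e; rewrite (color_heir e).
Qed.

Lemma color_below p : p \in nodes -> color p = p \/ encloses p (color p).
Proof.
elim/heir_ind => {}p.
  by move=> lp; left; rewrite color_None ?leaf_heir //; case/andP: lp.
move=> q hp e; rewrite (color_heir e).
have /childP[_ _ pq _] := heir_child e.
by case=> [->|]; right=> //; move: pq b; rewrite /encloses; lia.
Qed.

(** * Surviving boxes *)

Implicit Types (L s : seq node) (A B : set int).

Definition heads s : set int := [set Posz p.1 | p in [set` s]].

Definition tails s : set int := [set Posz p.2 | p in [set` s]].

Definition alive L p := (p \in nodes) && (color p \notin L).

(** The boxes left when the branches with colors in [L] have been deleted. The
    boxes outside [1, 2n] belong to no node, hence always remain. *)
Definition boxes L : set int :=
  [set x | forall p, p \in nodes -> color p \in L ->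
    x <> Posz p.1 /\ x <> Posz p.2].

Definition ancestor_closed L := forall p q, p \in nodes -> alive L q ->
  encloses p q -> alive L p.

Lemma alive_node L p : alive L p -> p \in nodes.
Proof. by case/andP. Qed.

(** Branches disappear as a whole, so a node and its heir survive together. *)
Lemma alive_heir L p q : heir p = Some q -> alive L p = alive L q.
Proof.
move=> e; have /childP[hq hp _ _] := heir_child e.
by rewrite /alive hp hq (color_heir e).
Qed.

Lemma alive_color L p : alive L p -> alive L (color p).
Proof.
case/andP=> hp nL; have lc := color_leaf hp; have /andP[hc _] := lc.
by rewrite /alive hc color_None // leaf_heir.
Qed.

Lemma boxes_left L p : alive L p -> boxes L (Posz p.1).
Proof.
case/andP=> hp nL q hq qL; split=> -[].
  by move/(node_inj_left hp hq) => e; rewrite e qL in nL.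
exact: node_left_neq_right.
Qed.

Lemma boxes_right L p : alive L p -> boxes L (Posz p.2).
Proof.
case/andP=> hp nL q hq qL; split=> -[].
  by move/esym; apply: node_left_neq_right.
by move/(node_inj_right hp hq) => e; rewrite e qL in nL.
Qed.

Lemma boxes_open L x : boxes L x -> eta x -> exists2 p, alive L p & x = Posz p.1.
Proof.
move=> Sx ex; have [i ei _] := ball_range ex; subst x.
have [j hij] := matched_open ex; have hp : (i, j) \in nodes by rewrite mem_nodes.
exists (i, j) => //; rewrite /alive hp; apply/negP => pL.
by have [] := Sx _ hp pL.
Qed.

Lemma boxes_close L x : boxes L x -> ~~ eta x -> (1 <= x <= (2 * n)%:Z)%R ->
  exists2 p, alive L p & x = Posz p.2.
Proof.
case: x => [j|//] Sx ex hx.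
have [i hij] := matched_close (j := j) ltac:(lia) ex.
have hp : (i, j) \in nodes by rewrite mem_nodes.
exists (i, j) => //; rewrite /alive hp; apply/negP => pL.
by have [] := Sx _ hp pL.
Qed.

Lemma boxes_outside L x : ~~ (1 <= x <= (2 * n)%:Z)%R -> boxes L x /\ ~~ eta x.
Proof.
move=> hx; split; last by apply/negP => /ball_range[i e]; subst x; lia.
by move=> p /node_bounds[b1 b2 _ _] _; split=> e; subst x; lia.
Qed.

(** Outside [1, 2n] all the boxes are empty and none is ever deleted, so such a
    run contains a half-line. *)
Lemma outside_infinite L x : ~~ (1 <= x <= (2 * n)%:Z)%R ->
  infinite_set (run_at eta (boxes L) x).
Proof.
move=> hx.
(* [e] is the direction pointing away from [1, 2n]. *)
have [e he] : exists e : int, (x <= 0 /\ e = -1)%R \/ ((2 * n)%:Z < x /\ e = 1)%R.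
  by case: (leP x 0) => x0; [exists (-1)%R; left | exists 1%R; right]; lia.
pose f (k : nat) := (x + e * k%:Z)%R.
have hf k : ~~ (1 <= f k <= (2 * n)%:Z)%R by rewrite /f; case: he => -[? ->]; lia.
apply/infiniteP.
have : f @` [set: nat] #= [set: nat].
  apply: inj_card_eq => i j _ _; rewrite /f.
  by case: he => -[_ ->]; lia.
rewrite card_eq_le => /andP[_ le]; apply: card_le_trans le _.
apply: subset_card_le => _ [k _ <-].
have [Sk _] := boxes_outside L (hf k); have [_ ex] := boxes_outside L hx.
split=> // z _ hz; have [_ ez] : boxes L z /\ ~~ eta z.
  by apply: boxes_outside; rewrite /f in hz; case: he hz => -[? ->]; lia.
by rewrite (negPf ez) (negPf ex).
Qed.

Lemma card_heads s : {subset s <= nodes} -> uniq s -> heads s #= `I_(size s).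
Proof.
move=> sn us; apply: card_image_uniq => // p q ps qs [].
by apply: node_inj_left; apply: sn.
Qed.

Lemma card_tails s : {subset s <= nodes} -> uniq s -> tails s #= `I_(size s).
Proof.
move=> sn us; apply: card_image_uniq => // p q ps qs [].
by apply: node_inj_right; apply: sn.
Qed.

(** * Chains *)

Section Chain.

Variables (L : seq node) (A B : set int).

(** [A] and [B] may here be any sets of ones and of zeros that form together an
    interval of the surviving boxes. *)
Definition adjacent := [/\ forall x, A x -> boxes L x /\ eta x,
  forall x, B x -> boxes L x /\ ~~ eta x, left_of A B &
  forall x y z : int, A x -> B z -> boxes L y -> (x <= y <= z)%R -> A y \/ B y].

Definition chain := [seq p <- nodes |
  [&& alive L p, `[< A (Posz p.1) >] & `[< B (Posz p.2) >]]].

Lemma chainP p :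
  reflect [/\ alive L p, A (Posz p.1) & B (Posz p.2)] (p \in chain).
Proof.
rewrite mem_filter; apply: (iffP andP) => [[/and3P[-> /asboolP ? /asboolP ?]]|].
  by [].
by case=> al /asboolP hA /asboolP hB; rewrite al hA hB (alive_node al).
Qed.

Lemma chain_uniq : uniq chain.
Proof. exact/filter_uniq/nodes_uniq. Qed.

Lemma chain_nodes : {subset chain <= nodes}.
Proof. by move=> p /chainP[/alive_node]. Qed.

Hypothesis adj : adjacent.

Lemma open_between x z p : A x -> B z -> alive L p ->
  (x <= Posz p.1 <= z)%R -> A (Posz p.1).
Proof.
case: adj => hA hB _ hAB Ax Bz al xpz.
have [_ _ e _] := node_bounds (alive_node al).
by have [//|/hB[_]] := hAB _ _ _ Ax Bz (boxes_left al) xpz; rewrite e.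
Qed.

Lemma close_between x z p : A x -> B z -> alive L p ->
  (x <= Posz p.2 <= z)%R -> B (Posz p.2).
Proof.
case: adj => hA hB _ hAB Ax Bz al xpz.
have [_ _ _ e] := node_bounds (alive_node al).
by have [/hA[_]|//] := hAB _ _ _ Ax Bz (boxes_right al) xpz; rewrite (negPf e).
Qed.

Lemma chain_nested p q : p \in chain -> q \in chain ->
  [\/ p = q, encloses p q | encloses q p].
Proof.
case: adj => _ _ lAB _ /chainP[alp Ap Bp] /chainP[alq Aq Bq].
have := lAB _ _ Ap Bq; have := lAB _ _ Aq Bp.
case: (node_cases (alive_node alp) (alive_node alq)); do ?by constructor.
by case; lia.
Qed.

Lemma chain_down p q : p \in chain -> alive L q -> encloses p q -> q \in chain.
Proof.
move=> /chainP[alp Ap Bp] alq pq; have [b _ _ _] := node_bounds (alive_node alq).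
apply/chainP; split=> //; [apply: (open_between Ap Bp) | apply: (close_between Ap Bp)];
  by move: pq; rewrite /encloses; lia.
Qed.

(** The node [p] closes beyond [B], so [B] lies strictly inside [p]; the partners
    of the boxes of [B] then lie between a box of [A] and [B], hence in [A]. *)
Lemma chain_tails_all p : alive L p -> A (Posz p.1) -> ~ B (Posz p.2) ->
  B `<=` tails chain.
Proof.
case: adj => _ hB lAB _ alp Ap nBp b Bb; have [Sb eb] := hB _ Bb.
have hp := alive_node alp; have [hp1 hp2 _ _] := node_bounds hp.
have pb := lAB _ _ Ap Bb.
have bp : (b < Posz p.2)%R.
  rewrite ltNge; apply/negP => le; apply: nBp.
  by apply: (close_between Ap Bb alp); lia.
have [q alq eq] := boxes_close Sb eb ltac:(lia); exists q => //=.
have hq := alive_node alq; have [hq1 hq2 _ _] := node_bounds hq; subst b.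
apply/chainP; split=> //; apply: (open_between Ap Bb alq).
have : encloses p q by apply: enclosesP_right => //; lia.
by rewrite /encloses; lia.
Qed.

(** Mirror image of [chain_tails_all]: here [A] lies strictly inside [p]. *)
Lemma chain_heads_all p : alive L p -> ~ A (Posz p.1) -> B (Posz p.2) ->
  A `<=` heads chain.
Proof.
case: adj => hA _ lAB _ alp nAp Bp a Aa; have [Sa ea] := hA _ Aa.
have hp := alive_node alp; have [hp1 hp2 _ _] := node_bounds hp.
have ap := lAB _ _ Aa Bp.
have pa : (Posz p.1 < a)%R.
  rewrite ltNge; apply/negP => le; apply: nAp.
  by apply: (open_between Aa Bp alp); lia.
have [q alq eq] := boxes_open Sa ea; exists q => //=.
have hq := alive_node alq; have [hq1 hq2 _ _] := node_bounds hq; subst a.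
apply/chainP; split=> //; apply: (close_between Aa Bp alq).
have : encloses p q by apply: enclosesP => //; lia.
by rewrite /encloses; lia.
Qed.

(** Either all the boxes of [A] are matched in [B], or by [chain_tails_all] all
    those of [B] are matched in [A]. *)
Lemma chain_size_ge K : `I_K #<= A -> `I_K #<= B -> K <= size chain.
Proof.
case: adj => hA hB _ _ KA KB.
case: (pselect (exists p, [/\ alive L p, A (Posz p.1) & ~ B (Posz p.2)])).
  case=> p [al Ap nBp]; apply: card_II_le (card_tails chain_nodes chain_uniq).
  exact/(card_le_trans KB)/subset_card_le/(chain_tails_all al).
move=> nex; apply: card_II_le (card_heads chain_nodes chain_uniq).
apply/(card_le_trans KA)/subset_card_le => a Aa; have [Sa ea] := hA _ Aa.
have [p al e] := boxes_open Sa ea; subst a; exists p => //; apply/chainP; split=> //.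
by apply: contrapT => nB; apply: nex; exists p.
Qed.

End Chain.

Lemma adjacent_runs L A B : one_run eta (boxes L) A -> zero_run eta (boxes L) B ->
  neighbors (boxes L) A B -> adjacent L A B.
Proof.
case=> -[[_ AS _ _] _] eA [[[_ BS _ _] _] eB] [lAB hAB]; split=> //.
  by move=> x Ax; split; [apply: AS | apply: eA].
by move=> x Bx; split; [apply: BS | rewrite eB].
Qed.

(** Generations are strictly increasing along nested nodes, so those of [s] are
    distinct numbers between 1 and [gen q]. *)
Lemma chain_generation s q : uniq s -> {subset s <= nodes} ->
  {in s &, forall p r, [\/ p = r, encloses p r | encloses r p]} ->
  (forall p, p \in s -> p = q \/ encloses q p) -> q \in nodes -> size s <= gen q.
Proof.
move=> us sn nest sq hq; rewrite -(size_map gen) -[gen q](size_iota 1).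
apply: uniq_leq_size.
  rewrite map_inj_in_uniq // => p r ps rs e; have [//|pr|rp] := nest _ _ ps rs.
    by have := generation_encloses (sn _ ps) (sn _ rs) pr; lia.
  by have := generation_encloses (sn _ rs) (sn _ ps) rp; lia.
move=> _ /mapP[p ps ->]; rewrite mem_iota.
have : gen p <= gen q.
  case: (sq _ ps) => [->//|qp].
  exact/ltnW/(generation_encloses hq (sn _ ps)).
by have := generationE (sn _ ps); lia.
Qed.

(** Going down from heir to heir lowers the generation by one each time, so every
    number between 1 and [gen p] is the generation of some node of [s]. *)
Lemma generation_le_size s p : p \in nodes -> p \in s ->
  (forall q r, q \in s -> heir q = Some r -> r \in s) -> gen p <= size s.
Proof.
move=> hp ps hs; rewrite -(size_map gen) -[gen p](size_iota 1).
apply: uniq_leq_size; first exact: iota_uniq.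
elim/heir_ind: hp ps => {}p.
  move=> /andP[hp /eqP ch] ps m; rewrite generationE // ch big_nil inE => /eqP->.
  by apply/mapP; exists p; rewrite // generationE // ch big_nil.
move=> q hp e IHq ps m; have [-> _] := heir_generation e.
rewrite -[(gen q).+1]addn1 iotaD mem_cat => /orP[|]; first exact/IHq/(hs p).
rewrite inE add1n => /eqP->; apply/mapP; exists p => //.
by have [-> _] := heir_generation e.
Qed.

(** * Runs around a leaf *)

Local Notation run_of L x := (run_at eta (boxes L) (Posz x)).

(** Nothing can survive between the two boxes of a leaf, because its node
    encloses no other node. *)
Lemma leaf_adjacent L c : alive L c -> leaf c ->
  adjacent L (run_of L c.1) (run_of L c.2).
Proof.
move=> alc lc; have hc := alive_node alc; have [c12 c2 e1 e2] := node_bounds hc.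
have S1 := boxes_left alc; have S2 := boxes_right alc.
apply: adjacent_runs; [exact: one_run_at | exact: zero_run_at |].
apply: run_neighbors => // [|y Sy cyc]; first by lia.
case: (boolP (eta y)) => ey.
  have [p alp e] := boxes_open Sy ey; subst y; have hp := alive_node alp.
  by have := leaf_encloses lc hp; rewrite enclosesP //; lia.
have [p alp e] := boxes_close Sy ey ltac:(lia); subst y; have hp := alive_node alp.
by have := leaf_encloses lc hp; rewrite enclosesP_right //; lia.
Qed.

Local Ltac order_lia :=
  repeat match goal with
  | H : context [ball_config] |- _ => clear H
  | H : context [alive] |- _ => clear H
  end; unfold encloses in *; lia.

Lemma leaf_under L q : alive L q ->
  exists c, [/\ leaf c, alive L c & q = c \/ encloses q c].
Proof.
move=> alq; have hq := alive_node alq; exists (color q).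
split; [exact: color_leaf | exact: alive_color |].
by case: (color_below hq) => [->|]; [left | right].
Qed.

(** The nodes of the chain around [c] are at least [K] by [chain_size_ge], and
    they all lie below [q] as none of them encloses it. *)
Lemma generation_ge_runs L c q K : alive L c -> leaf c -> q \in nodes ->
  q = c \/ encloses q c -> `I_K #<= run_of L c.1 -> `I_K #<= run_of L c.2 ->
  (forall p, p \in chain L (run_of L c.1) (run_of L c.2) -> ~~ encloses p q) ->
  K <= gen q.
Proof.
move=> alc lc hq qc K1 K2 top; have adj := leaf_adjacent alc lc.
apply: leq_trans (chain_size_ge adj K1 K2) _.
apply: chain_generation => //; first exact: chain_uniq.
- exact: chain_nodes.
- by move=> p r ps rs; apply: (chain_nested adj).
have hc := alive_node alc.
have cs : c \in chain L (run_of L c.1) (run_of L c.2).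
  apply/chainP; split=> //; apply: run_at_refl;
    [exact: boxes_left | exact: boxes_right].
move=> p ps; have hp := chain_nodes ps; have ntop := top _ ps.
have [b1 _ _ _] := node_bounds hc.
have [->|pc|cp] := chain_nested adj ps cs; first by case: qc; [left | right].
  case: (node_cases hp hq) => [->|pq|qp|dis]; [by left | | by right |].
    by rewrite pq in ntop.
  by exfalso; case: qc => [E|qc]; [subst q|]; order_lia.
by have := leaf_encloses lc hp; rewrite cp.
Qed.

Lemma sibling_above L p0 b : ancestor_closed L -> p0 \in nodes -> alive L b ->
  encloses p0 b -> exists q, [/\ q \in children p0, alive L q &
    q = b \/ encloses q b].
Proof.
move=> up hp0 alb pb; have [q hq qb] := child_above hp0 (alive_node alb) pb.
exists q; split=> //; case: qb => [->//|qb].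
exact: up (children_sub hq) alb qb.
Qed.

Lemma run_change L x y : boxes L x -> boxes L y -> ~ run_at eta (boxes L) x y ->
  exists z, [/\ boxes L z, (x <= z <= y)%R || (y <= z <= x)%R & eta z = ~~ eta x].
Proof.
move=> Sx Sy nxy; apply: contrapT => nex; apply: nxy; split=> // z Sz xzy.
apply: contrapT => ne; apply: nex; exists z; split=> //.
by case: (eta z) (eta x) ne => -[].
Qed.

Lemma smallest_run_le L k A R : leftmost_smallest_run eta (boxes L) k A ->
  run eta (boxes L) R -> `I_k #<= R.
Proof. by case=> _ Ak min _ /min; rewrite (card_le_eql Ak). Qed.

Lemma smallest_run_lt L k A R : leftmost_smallest_run eta (boxes L) k A ->
  run eta (boxes L) R -> R <> A -> ~ left_of A R -> `I_k.+1 #<= R.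
Proof.
move=> sm rR neq nlA; apply: card_II_succ; first exact: smallest_run_le sm rR.
case: sm => _ Ak _ lm Rk; apply: nlA; apply: lm => //.
by rewrite (card_eql Rk) card_eq_sym.
Qed.

(** If [p0] did not open in [A], a zero would separate it from [A]. The child [q]
    of [p0] containing this zero lies to the left of [p1], and the runs around a
    leaf below [q] have more than [k] boxes, since [A] is the leftmost run of
    smallest size. The run of zeros after this leaf stays inside [q]: one of its
    nodes enclosing [q] would lie between [q] and its parent [p0]. Hence [q] has
    generation larger than [k], and [p1] is not the heir of [p0]. *)
Lemma one_run_top L k A p0 p1 : ancestor_closed L ->
  leftmost_smallest_run eta (boxes L) k A -> (forall x, A x -> eta x) ->
  alive L p0 -> heir p0 = Some p1 -> gen p1 <= k -> A (Posz p1.1) ->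
  A (Posz p0.1).
Proof.
move=> up sm eA al0 e gk Ap1; apply: contrapT => nAp0.
have rA : run eta (boxes L) A by case: sm.
have al1 : alive L p1 by rewrite -(alive_heir L e).
have h0 := alive_node al0; have h1 := alive_node al1.
have [b01 b02 e01 e02] := node_bounds h0; have [b11 b12 e11 e12] := node_bounds h1.
have ch1 := heir_child e; have /childP[_ _ en01 inn1] := ch1.
have [z [Sz zb ez]] : exists z, [/\ boxes L z,
    (Posz p1.1 <= z <= Posz p0.1)%R || (Posz p0.1 <= z <= Posz p1.1)%R &
    eta z = ~~ eta (Posz p1.1)].
  apply: run_change; [exact: boxes_left | exact: boxes_left |].
  by rewrite -(run_eq rA Ap1).
have {}zb : (Posz p0.1 < z < Posz p1.1)%R.
  have z0 : z <> Posz p0.1 by move=> E; rewrite E e01 e11 in ez.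
  have z1 : z <> Posz p1.1 by move=> E; rewrite E e11 in ez.
  by order_lia.
rewrite e11 /= in ez; have [b alb eb] := boxes_close Sz (negbT ez) ltac:(order_lia).
subst z; have hb := alive_node alb; have [bb1 bb2 _ _] := node_bounds hb.
have en0b : encloses p0 b.
  by apply: enclosesP_right => //; order_lia.
have [q [chq alq qb]] := sibling_above up h0 alb en0b.
have hq := alive_node alq; have [bq1 bq2 eq1 eq2] := node_bounds hq.
have q_le_b : q.1 <= b.1 /\ b.2 <= q.2.
  by case: qb => [E|qb]; [subst q | split; order_lia].
have qp1 : q.2 < p1.1.
  by case: (siblings_disjoint chq ch1) => [E|//|lt]; [subst q; order_lia | order_lia].
have /childP[_ _ en0q innq] := chq.
have [c [lc alc qc]] := leaf_under alq.
have hc := alive_node alc; have [bc1 bc2 ec1 ec2] := node_bounds hc.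
have q_le_c : q.1 <= c.1 /\ c.2 <= q.2.
  by case: qc => [E|qc]; [subst q | split; order_lia].
have S1 := boxes_left alc; have S2 := boxes_right alc.
have gq : k.+1 <= gen q.
  apply: (generation_ge_runs alc lc hq qc).
  - apply: (smallest_run_lt sm); first exact: run_run_at.
      move=> E; have r1 : run_of L c.1 (Posz p1.1) by rewrite E.
      have := run_at_convex (run_at_refl _ S1) r1 (boxes_right alq) ltac:(order_lia).
      by move/run_at_eta; rewrite ec1 (negPf eq2).
    by move=> /(_ _ _ Ap1 (run_at_refl _ S1)); order_lia.
  - apply: (smallest_run_lt sm); first exact: run_run_at.
      by move=> E; have := run_at_refl eta S2; rewrite E => /eA; rewrite (negPf ec2).
    by move=> /(_ _ _ Ap1 (run_at_refl _ S2)); order_lia.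
  - move=> p /chainP[alp _ rp]; apply/negP => pq; have hp := alive_node alp.
    have lt : p.2 < p1.1.
      rewrite ltnNge; apply/negP => le.
      have := run_at_convex (run_at_refl _ S2) rp (boxes_left al1) ltac:(order_lia).
      by move/run_at_eta; rewrite e11 (negPf ec2).
    case: (innq _ hp pq) => [E|]; first by subst p; order_lia.
    by order_lia.
have [_ /(_ _ chq)[le _]] := heir_generation e.
by move: (leq_trans gq (leq_trans le gk)); rewrite ltnn.
Qed.

(** If [p0] did not close in [B], a one would separate it from [B]. The child [q]
    of [p0] containing this one lies to the right of [p1], and the runs around a
    leaf below [q] have at least [k] boxes, since no run is smaller than [B].
    Hence [q] has generation at least [k], and the rule of the rightmost child
    prefers it to [p1]. *)
Lemma zero_run_top L k B p0 p1 : ancestor_closed L ->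
  leftmost_smallest_run eta (boxes L) k B -> (forall x, B x -> ~~ eta x) ->
  alive L p0 -> heir p0 = Some p1 -> gen p1 <= k -> B (Posz p1.2) ->
  B (Posz p0.2).
Proof.
move=> up sm eB al0 e gk Bp1; apply: contrapT => nBp0.
have rB : run eta (boxes L) B by case: sm.
have al1 : alive L p1 by rewrite -(alive_heir L e).
have h0 := alive_node al0; have h1 := alive_node al1.
have [b01 b02 e01 e02] := node_bounds h0; have [b11 b12 e11 e12] := node_bounds h1.
have ch1 := heir_child e; have /childP[_ _ en01 inn1] := ch1.
have [z [Sz zb ez]] : exists z, [/\ boxes L z,
    (Posz p1.2 <= z <= Posz p0.2)%R || (Posz p0.2 <= z <= Posz p1.2)%R &
    eta z = ~~ eta (Posz p1.2)].
  apply: run_change; [exact: boxes_right | exact: boxes_right |].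
  by rewrite -(run_eq rB Bp1).
rewrite e12 in ez.
have {}zb : (Posz p1.2 < z < Posz p0.2)%R.
  have z0 : z <> Posz p0.2 by move=> E; rewrite -E ez in e02.
  have z1 : z <> Posz p1.2 by move=> E; rewrite -E ez in e12.
  by order_lia.
have [b alb eb] := boxes_open Sz ez.
subst z; have hb := alive_node alb; have [bb1 bb2 _ _] := node_bounds hb.
have en0b : encloses p0 b.
  by apply: enclosesP => //; order_lia.
have [q [chq alq qb]] := sibling_above up h0 alb en0b.
have hq := alive_node alq; have [bq1 bq2 eq1 eq2] := node_bounds hq.
have q_le_b : q.1 <= b.1 /\ b.2 <= q.2.
  by case: qb => [E|qb]; [subst q | split; order_lia].
have qp1 : p1.2 < q.1.
  by case: (siblings_disjoint chq ch1) => [E|lt|//]; [subst q; order_lia | order_lia].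
have /childP[_ _ en0q innq] := chq.
have [c [lc alc qc]] := leaf_under alq.
have hc := alive_node alc; have [bc1 bc2 ec1 ec2] := node_bounds hc.
have q_le_c : q.1 <= c.1 /\ c.2 <= q.2.
  by case: qc => [E|qc]; [subst q | split; order_lia].
have S1 := boxes_left alc; have S2 := boxes_right alc.
have gq : k <= gen q.
  apply: (generation_ge_runs alc lc hq qc).
  - by apply: (smallest_run_le sm); apply: run_run_at.
  - by apply: (smallest_run_le sm); apply: run_run_at.
  - move=> p /chainP[alp rp _]; apply/negP => pq; have hp := alive_node alp.
    have lt : p1.2 < p.1.
      rewrite ltnNge; apply/negP => le.
      have := run_at_convex rp (run_at_refl _ S1) (boxes_right al1) ltac:(order_lia).
      by move/run_at_eta; rewrite ec1 (negPf e12).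
    case: (innq _ hp pq) => [E|]; first by subst p; order_lia.
    by order_lia.
have [_ /(_ _ chq)[le le']] := heir_generation e.
have {}le' := le' (anti_leq (introT andP (conj le (leq_trans gk gq)))).
by order_lia.
Qed.

(** * A step of the procedure removes a branch *)

Lemma branchP c p : (p \in branch c) = (p \in nodes) && (color p == c).
Proof. by rewrite mem_filter andbC. Qed.

Lemma branch_uniq c : uniq (branch c).
Proof. exact/filter_uniq/nodes_uniq. Qed.

Lemma heads_eq s s' : s =i s' -> heads s = heads s'.
Proof. by move=> e; apply/seteqP; split=> _ [p ps <-]; exists p; rewrite //= ?e // -e. Qed.

Lemma tails_eq s s' : s =i s' -> tails s = tails s'.
Proof. by move=> e; apply/seteqP; split=> _ [p ps <-]; exists p; rewrite //= ?e // -e. Qed.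

Lemma boxes_cons L c :
  boxes (c :: L) = boxes L `\` (heads (branch c) `|` tails (branch c)).
Proof.
apply/seteqP; split=> x.
  move=> Sx; split=> [p hp pL|]; first by apply: Sx; rewrite // inE pL orbT.
  by case=> -[p /=]; rewrite branchP => /andP[hp /eqP pc] e; subst x;
    have [] := Sx p hp ltac:(by rewrite pc mem_head).
case=> Sx nb p hp; rewrite inE => /orP[pc|]; last exact: Sx.
by split=> e; apply: nb; [left | right]; exists p; rewrite //= branchP hp.
Qed.

Lemma boxes_nil : boxes [::] = setT.
Proof. by apply/seteqP; split=> // x _ p. Qed.

Lemma leaf_alive L c : leaf c -> c \notin L -> alive L c.
Proof.
move=> lc cL; have /andP[hc _] := lc.
by rewrite /alive hc color_None // leaf_heir.
Qed.

(** The colors of the nodes of [s] are leaves and belong to [s], so they are equal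
    because [s] is nested; a node of this color is in [s] since its descent along
    heirs ends in [s]. Every survivor below a node of [s] is deleted with it, so
    the survivors remain closed under taking ancestors. *)
Lemma chain_branch L s p : ancestor_closed L -> (forall p, p \in s -> alive L p) ->
  p \in s ->
  {in s &, forall p q, [\/ p = q, encloses p q | encloses q p]} ->
  (forall p q, p \in s -> alive L q -> encloses p q -> q \in s) ->
  (forall p q, alive L p -> heir p = Some q -> q \in s -> p \in s) ->
  exists c, [/\ leaf c, c \notin L, ancestor_closed (c :: L) & s =i branch c].
Proof.
move=> up als ps nest down top.
have cs q : q \in s -> color q \in s.
  move=> qs; have alq := als _ qs.
  case: (color_below (alive_node alq)) => [->//|]; apply: down => //.
  exact: alive_color.
have cc q : q \in s -> color q = color p.
  move=> qs; have lq := color_leaf (alive_node (als _ qs)).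
  have lp := color_leaf (alive_node (als _ ps)).
  have [//|e|e] := nest _ _ (cs _ qs) (cs _ ps).
    by have := leaf_encloses lq (alive_node (als _ (cs _ ps))); rewrite e.
  by have := leaf_encloses lp (alive_node (als _ (cs _ qs))); rewrite e.
have cL : color p \notin L by have /andP[] := als _ ps.
have sc : s =i branch (color p).
  move=> q; rewrite branchP; apply/idP/andP => [qs|[hq /eqP]].
    by rewrite (cc _ qs) (alive_node (als _ qs)).
  elim/heir_ind: hq => {}q.
    move=> lq; have /andP[hq _] := lq.
    by rewrite color_None ?leaf_heir // => ->; apply: cs.
  move=> r hq e IH cq; apply: (top _ _ _ e); first by rewrite /alive hq cq.
  by apply: IH; rewrite -cq (color_heir e).
exists (color p); split=> //; first exact/color_leaf/alive_node/als.
move=> q r hq /andP[hr]; rewrite inE negb_or => /andP[rc rL] qr.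
have alr : alive L r by rewrite /alive hr.
have /andP[_ qL] := up _ _ hq alr qr.
rewrite /alive hq inE negb_or qL andbT; apply: contraNneq rc => qc.
by apply/eqP/cc; apply: (down q) => //; rewrite sc branchP hq qc eqxx.
Qed.

(** Any chain is closed downwards, so that only its top is left to examine, and
    the generations of its nodes are bounded by its size. *)
Lemma chain_soliton L A B k : ancestor_closed L -> adjacent L A B ->
  size (chain L A B) = k -> chain L A B != [::] ->
  (forall p q, gen q <= k -> alive L p -> heir p = Some q ->
     q \in chain L A B -> p \in chain L A B) ->
  exists c, [/\ leaf c, c \notin L, ancestor_closed (c :: L) &
    chain L A B =i branch c].
Proof.
move=> up adj sk; case E: (chain L A B) => [//|p s0] _; rewrite -E => top.
apply: (@chain_branch _ _ p) => //.
- by move=> q /chainP[].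
- by rewrite E mem_head.
- by move=> q r qs rs; apply: (chain_nested adj).
- by move=> q r; apply: (chain_down adj).
move=> q r alq e rs; apply: (top q r) => //; rewrite -sk.
apply: generation_le_size => //; first exact: chain_nodes rs.
move=> t u ts eu; have /chainP[alt _ _] := ts.
have /childP[_ _ tu _] := heir_child eu.
by apply: (chain_down adj ts) tu; rewrite -(alive_heir L eu).
Qed.

Lemma branch_size s c : uniq s -> s =i branch c -> size (branch c) = size s.
Proof.
by move=> us e; apply/esym/perm_size/uniq_perm => //; apply: branch_uniq.
Qed.

(** If some box of [A] were matched beyond [B], then the at least [k] boxes of [B]
    would be matched inside [A] without this box, which leaves only [k - 1]. *)
Lemma one_run_step L k A B : ancestor_closed L ->
  leftmost_smallest_run eta (boxes L) k A -> one_run eta (boxes L) A ->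
  zero_run eta (boxes L) B -> neighbors (boxes L) A B ->
  exists c, [/\ leaf c, c \notin L, ancestor_closed (c :: L) &
    [/\ k = size (branch c), A = heads (branch c) &
        leftmost_boxes k B (tails (branch c))]].
Proof.
move=> up sm oA zB nAB; have adj := adjacent_runs oA zB nAB.
have [hA hB lAB _] := adj; have [_ Ak _ _] := sm.
pose s := chain L A B.
have us : uniq s := chain_uniq _ _ _; have sn : {subset s <= nodes} := @chain_nodes _ _ _.
have sA p : alive L p -> A (Posz p.1) -> p \in s.
  move=> al Ap; apply/chainP; split=> //; apply: contrapT => nB.
  (* Now all of [B] is matched inside [A], away from the left box of [p]. *)
  have kB : k <= size s.
    apply: card_II_le (card_tails sn us).
    apply: card_le_trans (smallest_run_le sm (proj1 zB)) _.
    exact/subset_card_le/(chain_tails_all adj al).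
  have ps : p \notin s by apply/negP => /chainP[].
  suff : (size s).+1 <= k by rewrite ltnNge kB.
  have cps : heads (p :: s) #= `I_(size s).+1.
    apply: (@card_heads (p :: s)); rewrite /= ?ps //.
    by move=> q; rewrite inE => /orP[/eqP->|/sn//]; apply: alive_node al.
  apply: card_II_le Ak; rewrite -(card_le_eql cps); apply: subset_card_le => _ [q /= qs <-].
  by move: qs; rewrite inE => /orP[/eqP->//|/chainP[]].
have eA : A = heads s.
  apply/seteqP; split=> [a Aa|_ [p /chainP[_ Ap _] <-] //].
  have [Sa ea] := hA _ Aa; have [p al e] := boxes_open Sa ea; subst a.
  by exists p => //; apply: sA.
have sk : size s = k by apply: (card_II_inj _ Ak); rewrite eA; apply: card_heads.
have [c [lc cL upc sc]] : exists c, [/\ leaf c, c \notin L,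
    ancestor_closed (c :: L) & s =i branch c].
  apply: (chain_soliton up adj sk).
    have [[[[a Aa] _ _ _] _] _] := oA.
    have [p ps _] : heads s a by rewrite -eA.
    by apply/eqP => E; have : p \in s := ps; rewrite /s E.
  move=> p q gq al e /chainP[_ Aq _]; apply: sA => //.
  by apply: (one_run_top up sm _ al e gq Aq) => x /hA[].
exists c; split=> //; rewrite -(heads_eq sc) -(tails_eq sc) (branch_size us sc) sk.
split=> //; split; first by move=> _ [p /chainP[_ _ Bp] <-].
  by rewrite -sk; apply: card_tails.
move=> _ z [p /= ps <-] [Bz nz]; rewrite ltNge; apply/negP => le; apply: nz.
have /chainP[alp Ap Bp] := ps; have hp := alive_node alp.
have [Sz ez] := hB _ Bz; have pz := lAB _ _ Ap Bz.
have [b1 b2 e1 e2] := node_bounds hp.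
have [q alq e] := boxes_close Sz ez ltac:(order_lia); subst z; exists q => //=.
case: (eqVneq p q) => [<-//|ne]; have hq := alive_node alq.
apply: (chain_down adj ps alq); apply: enclosesP_right => //.
have ne2 : (p : node).2 <> q.2 by move/(node_inj_right hp hq)/eqP; rewrite (negPf ne).
by order_lia.
Qed.

(** As in [one_run_step], with the roles of [A] and [B] exchanged. *)
Lemma zero_run_step L k A B : ancestor_closed L ->
  leftmost_smallest_run eta (boxes L) k B -> one_run eta (boxes L) A ->
  zero_run eta (boxes L) B -> neighbors (boxes L) A B ->
  exists c, [/\ leaf c, c \notin L, ancestor_closed (c :: L) &
    [/\ k = size (branch c), B = tails (branch c) &
        rightmost_boxes k A (heads (branch c))]].
Proof.
move=> up sm oA zB nAB; have adj := adjacent_runs oA zB nAB.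
have [hA hB lAB _] := adj; have [_ Bk _ _] := sm.
pose s := chain L A B.
have us : uniq s := chain_uniq _ _ _; have sn : {subset s <= nodes} := @chain_nodes _ _ _.
have sB p : alive L p -> B (Posz p.2) -> p \in s.
  move=> al Bp; apply/chainP; split=> //; apply: contrapT => nA.
  (* Now all of [A] is matched inside [B], away from the right box of [p]. *)
  have kA : k <= size s.
    apply: card_II_le (card_heads sn us).
    apply: card_le_trans (smallest_run_le sm (proj1 oA)) _.
    exact/subset_card_le/(chain_heads_all adj al).
  have ps : p \notin s by apply/negP => /chainP[].
  suff : (size s).+1 <= k by rewrite ltnNge kA.
  have cps : tails (p :: s) #= `I_(size s).+1.
    apply: (@card_tails (p :: s)); rewrite /= ?ps //.
    by move=> q; rewrite inE => /orP[/eqP->|/sn//]; apply: alive_node al.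
  apply: card_II_le Bk; rewrite -(card_le_eql cps); apply: subset_card_le => _ [q /= qs <-].
  by move: qs; rewrite inE => /orP[/eqP->//|/chainP[]].
(* The run has [k] boxes, so it is not one of the infinite runs of zeros. *)
have finB x : B x -> (1 <= x <= (2 * n)%:Z)%R.
  move=> Bx; apply: contrapT => /negP /(outside_infinite (L := L)).
  rewrite -(run_eq (proj1 zB) Bx); apply; apply/finite_setP; by exists k.
have eB : B = tails s.
  apply/seteqP; split=> [b Bb|_ [p /chainP[_ _ Bp] <-] //].
  have [Sb eb] := hB _ Bb; have [p al e] := boxes_close Sb eb (finB _ Bb); subst b.
  by exists p => //; apply: sB.
have sk : size s = k by apply: (card_II_inj _ Bk); rewrite eB; apply: card_tails.
have [c [lc cL upc sc]] : exists c, [/\ leaf c, c \notin L,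
    ancestor_closed (c :: L) & s =i branch c].
  apply: (chain_soliton up adj sk).
    have [[[[b Bb] _ _ _] _] _] := zB.
    have [p ps _] : tails s b by rewrite -eB.
    by apply/eqP => E; have : p \in s := ps; rewrite /s E.
  move=> p q gq al e /chainP[_ _ Bq]; apply: sB => //.
  by apply: (zero_run_top up sm _ al e gq Bq) => x /hB[].
exists c; split=> //; rewrite -(heads_eq sc) -(tails_eq sc) (branch_size us sc) sk.
split=> //; split; first by move=> _ [p /chainP[_ Ap _] <-].
  by rewrite -sk; apply: card_heads.
move=> z _ [Az nz] [p /= ps <-]; rewrite ltNge; apply/negP => le; apply: nz.
have /chainP[alp Ap Bp] := ps; have hp := alive_node alp.
have [Sz ez] := hA _ Az; have zp := lAB _ _ Az Bp.
have [q alq e] := boxes_open Sz ez; subst z; exists q => //=.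
case: (eqVneq p q) => [<-//|ne]; have hq := alive_node alq.
apply: (chain_down adj ps alq); apply: enclosesP => //.
have ne2 : (p : node).1 <> q.1 by move/(node_inj_left hp hq)/eqP; rewrite (negPf ne).
by order_lia.
Qed.

(** * Running the procedure *)

Definition soliton_of c : soliton :=
  (size (branch c), (heads (branch c), tails (branch c))).

Lemma HT_step_soliton L x : ancestor_closed L -> HT_step eta (boxes L) x ->
  exists c, [/\ leaf c, c \notin L, ancestor_closed (c :: L) & x = soliton_of c].
Proof.
case: x => k [hd tl] up [] [R [sm]].
  move=> oA zB nAB lB.
  have [c [lc cL upc [ek ehd lc']]] := one_run_step up sm oA zB nAB.
  exists c; split=> //; rewrite (leftmost_boxes_inj lB lc').
  by rewrite /soliton_of -ek -ehd.
move=> zB oA nAB lB.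
have [c [lc cL upc [ek etl lc']]] := zero_run_step up sm oA zB nAB.
exists c; split=> //; rewrite (rightmost_boxes_inj lB lc').
by rewrite /soliton_of -ek -etl.
Qed.

(** A surviving node gives a finite run of ones, so that a smallest size exists;
    the finite runs lie in [1, 2n], so that one of them is the leftmost. *)
Lemma leftmost_smallest_run_exists L p : alive L p -> exists i k,
  [/\ 1 <= i <= 2 * n, boxes L (Posz i) &
      leftmost_smallest_run eta (boxes L) k (run_of L i)].
Proof.
move=> al; have S1 := boxes_left al; have [_ _ e1 _] := node_bounds (alive_node al).
have fin x k : run_at eta (boxes L) x #= `I_k ->
    exists2 i, x = Posz i & 1 <= i <= 2 * n.
  move=> xk; have hx : (1 <= x <= (2 * n)%:Z)%R.
    apply: contrapT => /negP /(outside_infinite (L := L)); apply.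
    by apply/finite_setP; exists k.
  by case: x hx {xk} => [i|i] hx; [exists i; lia | lia].
pose P k := `[< exists2 x, boxes L x & run_at eta (boxes L) x #= `I_k >].
have exP : exists k, P k.
  have /finite_setP[k Ak] : finite_set (run_of L p.1).
    apply: (@sub_finite_set _ _ (heads nodes)); last exact/finite_image/finite_seq.
    move=> x rx; have [q alq e] : exists2 q, alive L q & x = Posz q.1.
      by apply: boxes_open (run_at_sub rx) _; rewrite (run_at_eta rx).
    by exists q; rewrite //= (alive_node alq).
  by exists k; apply/asboolP; exists (Posz p.1).
case: (ex_minnP exP) => k /asboolP[x Sx xk] kmin.
pose Q i := `[< boxes L (Posz i) /\ run_of L i #= `I_k >].
have exQ : exists i, Q i.
  by have [i e _] := fin _ _ xk; exists i; apply/asboolP; rewrite -e.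
case: (ex_minnP exQ) => i /asboolP[Si ik] imin.
have rA : run eta (boxes L) (run_of L i) by apply: run_run_at.
exists i, k; split=> //; first by have [_ [<-]] := fin _ _ ik.
split=> // [R rR | R rR eR neR].
  have [y Sy eR] := run_witness rR; rewrite (card_le_eql ik).
  case: (pselect (finite_set R)) => [/finite_setP[m Rm]|].
    rewrite (card_le_eqr Rm) card_le_II; apply: kmin; apply/asboolP.
    by exists y; rewrite -?eR.
  by move/infiniteP; apply: card_le_trans; apply: card_leT.
have neAR : run_of L i <> R by move=> e; apply: neR.
case: (runs_ordered rA rR neAR) => // lRA.
have [y Sy ey] := run_witness rR.
have yk : run_at eta (boxes L) y #= `I_k by rewrite -ey (card_eql eR).
have [j ej _] := fin _ _ yk; subst y.
have := imin j ltac:(by apply/asboolP).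
have := lRA (Posz j) (Posz i); rewrite ey.
by move=> /(_ (run_at_refl _ Sy) (run_at_refl _ Si)); lia.
Qed.

(** The run sought is that of the first surviving empty box after [i], which exists
    since box [2n + 1] is empty and survives. *)
Lemma next_zero_run L i : boxes L (Posz i) -> eta (Posz i) ->
  exists2 j, boxes L (Posz j) /\ ~~ eta (Posz j) &
    neighbors (boxes L) (run_of L i) (run_of L j).
Proof.
move=> Si ei; have [_ [<-] hi] := ball_range ei.
pose P j := (i < j) && ~~ eta (Posz j) && `[< boxes L (Posz j) >].
have exP : exists j, P j.
  exists (2 * n).+1; have [S0 e0] := boxes_outside L (x := Posz (2 * n).+1) ltac:(lia).
  by rewrite /P e0; apply/andP; split; [lia | apply/asboolP].
case: (ex_minnP exP) => j /andP[/andP[ij ej] /asboolP Sj] jmin; exists j => //.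
apply: run_neighbors => // z Sz zb.
left; split=> // v Sv vb; rewrite ei; apply: contrapT => /negP ev.
case: v Sv vb ev => [v|v] Sv vb ev; last by lia.
case: (eqVneq v i) => [e|ne]; first by rewrite e ei in ev.
have := jmin v; rewrite /P ev (asboolT Sv).
have iv : i < v by clear - ne vb zb; lia.
by rewrite iv => /(_ isT); clear - zb vb; lia.
Qed.

(** The run sought is that of the last surviving occupied box before [i], which
    exists since the partner of [i] is such a box. *)
Lemma previous_one_run L i : boxes L (Posz i) -> ~~ eta (Posz i) ->
  1 <= i <= 2 * n ->
  exists2 j, boxes L (Posz j) /\ eta (Posz j) &
    neighbors (boxes L) (run_of L j) (run_of L i).
Proof.
move=> Si ei hi.
pose P j := (j < i) && eta (Posz j) && `[< boxes L (Posz j) >].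
have exP : exists j, P j.
  have [q alq [e]] := boxes_close Si ei hi; subst i; exists q.1.
  have [b _ e1 _] := node_bounds (alive_node alq).
  by rewrite /P e1; apply/andP; split; [lia | exact/asboolP/boxes_left].
have bd j : P j -> j <= i by move=> /andP[/andP[/ltnW]].
case: (ex_maxnP exP bd) => j /andP[/andP[ji ej] /asboolP Sj] jmax; exists j => //.
apply: run_neighbors => // z Sz zb.
right; split=> // v Sv vb; rewrite (negPf ei); apply/negP => ev.
case: v Sv vb ev => [v|v] Sv vb ev; last by clear - vb zb; lia.
case: (eqVneq v i) => [e|ne]; first by rewrite -e ev in ei.
have := jmax v; rewrite /P ev (asboolT Sv).
have vi : v < i by clear - ne vb zb; lia.
by rewrite vi => /(_ isT); clear - zb vb; lia.
Qed.

Lemma HT_step_exists L p : ancestor_closed L -> alive L p ->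
  exists x, HT_step eta (boxes L) x.
Proof.
move=> up al; have [i [k [hi Si sm]]] := leftmost_smallest_run_exists al.
case: (boolP (eta (Posz i))) => ei.
  have [j [Sj ej] nAB] := next_zero_run Si ei.
  have oA := one_run_at Si ei; have zB := zero_run_at Sj ej.
  have [c [_ _ _ [_ _ lc]]] := one_run_step up sm oA zB nAB.
  by exists (k, (run_of L i, tails (branch c))); left; exists (run_of L j).
have [j [Sj ej] nAB] := previous_one_run Si ei hi.
have oA := one_run_at Sj ej; have zB := zero_run_at Si ei.
have [c [_ _ _ [_ _ lc]]] := zero_run_step up sm oA zB nAB.
by exists (k, (heads (branch c), run_of L i)); right; exists (run_of L j).
Qed.

Lemma only_one_infinite_runP L :
  only_one_infinite_run eta (boxes L) <-> forall p, ~~ alive L p.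
Proof.
have [S0 e0] := boxes_outside L (x := 0%R) ltac:(lia).
split=> [[R [_ _ uR]] p|dead].
  apply/negP => al; have [_ _ e1 _] := node_bounds (alive_node al).
  have S1 := boxes_left al; have : run_at eta (boxes L) 0%R (Posz p.1).
    by rewrite (uR _ (run_run_at _ S0)) -(uR _ (run_run_at _ S1)); apply: run_at_refl.
  by move/run_at_eta; rewrite e1 (negPf e0).
have all0 x : boxes L x -> eta x = false.
  move=> Sx; apply/negP => ex; have [p al _] := boxes_open Sx ex.
  by have := dead p; rewrite al.
exists (run_at eta (boxes L) 0%R); split; first exact: run_run_at.
  by apply: outside_infinite; lia.
move=> R rR; have [x Sx eR] := run_witness rR; apply: (run_eq rR).
by rewrite eR; split=> // z Sz _; rewrite !all0.
Qed.

(** By induction along the execution; each step adds to [L] the color of the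
    branch it deletes. *)
Lemma mem_execution S l L : HT_execution eta S l -> S = boxes L ->
  ancestor_closed L -> forall x, x \in l <->
    exists c, [/\ leaf c, c \notin L & x = soliton_of c].
Proof.
move=> ex; elim: ex L => {S l} [S stop|S s l _ step _ IHl] L eS up x; subst S.
  split=> // -[c [lc cL _]].
  by have := proj1 (only_one_infinite_runP L) stop c; rewrite (leaf_alive lc cL).
have [c [lc cL upc es]] := HT_step_soliton up step.
have eS : boxes L `\` (s.2.1 `|` s.2.2) = boxes (c :: L).
  by rewrite es boxes_cons.
have [h1 h2] := IHl _ eS upc x.
rewrite inE; split=> [/orP[/eqP->|/h1[d [ld]]]|[d [ld dL e]]].
- by exists c.
- by rewrite inE negb_or => /andP[_ dL] e; exists d.
case: (eqVneq d c) => [dc|ne]; first by rewrite e es dc eqxx.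
by apply/orP; right; apply: h2; exists d; rewrite inE negb_or ne.
Qed.

(** By induction on the number of surviving nodes, which decreases at each step. *)
Lemma execution_exists L : ancestor_closed L ->
  exists l, HT_execution eta (boxes L) l.
Proof.
have [m] := ubnP (size [seq p <- nodes | alive L p]).
elim: m L => // m IHm L le_m up.
case: (pselect (only_one_infinite_run eta (boxes L))) => [stop|nstop].
  by exists [::]; apply: HT_stop.
have [p al] : exists p, alive L p.
  apply: contrapT => nex; apply/nstop/only_one_infinite_runP => p.
  by apply/negP => al; apply: nex; exists p.
have [x step] := HT_step_exists up al.
have [c [lc cL upc ex]] := HT_step_soliton up step.
have alc := leaf_alive lc cL.
have [|l hl] := IHm (c :: L) _ upc.
  rewrite -ltnS; apply: leq_trans le_m; rewrite ltnS.
  apply: (@uniq_leq_size _ (c :: [seq p <- nodes | alive (c :: L) p])).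
    rewrite /= filter_uniq ?nodes_uniq // andbT mem_filter /alive.
    by rewrite color_None ?leaf_heir ?(alive_node alc) // mem_head andbF.
  move=> q; rewrite inE !(mem_filter (alive _)) => /orP[/eqP->|/andP[]].
    by rewrite alc (alive_node alc).
  by rewrite /alive inE negb_or => /andP[-> /andP[_ ->]].
exists (x :: l); apply: HT_continue => //.
by rewrite ex -boxes_cons.
Qed.

End Excursion.

Theorem proposition4 (n : nat) (eps : seq nat) (heps : soft_excursion n eps)
    (k : nat) (hk : (1 <= k)%N) :
  HT_solitons n eps k = tree_solitons n eps k.
Proof.
have up : ancestor_closed n eps [::].
  by move=> p q hp _ _; rewrite /alive hp.
apply/seteqP; split=> -[hd tl] /=.
  case=> l ex /(mem_execution heps ex (esym (boxes_nil _ _)) up)[c [lc _]].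
  by move=> [-> -> ->]; exists c.
case=> c [lc /= <- -> ->].
have [l ex] := execution_exists heps up; rewrite boxes_nil in ex.
exists l => //; apply/(mem_execution heps ex (esym (boxes_nil _ _)) up).
by exists c.
Qed.
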